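(* Let $n\geq 2$, let $S_n^0$ be the crown graph on $2n$ vertices, and put $a=2n(n-1)$. Then the Lanzhou spectrum of $S_n^0$ consists of $-a$ with multiplicity $n-1$, $a(n-1)$ with multiplicity $1$, $a$ with multiplicity $n-1$, and $-a(n-1)$ with multiplicity $1$ (multiplicities being added if values coincide). Moreover, $In(A_{Lz}(S_n^0))=(n,n,0)$ for all $n\geq 2$.
   Context: Graphs are finite, simple and undirected. For a graph $G$ on $N$ vertices, $d_G(u)$ is the degree of $u$ in $G$ and $d_{\overline{G}}(u)=N-1-d_G(u)$ is its degree in the complement $\overline{G}$. The Lanzhou matrix $A_{Lz}(G)$ is the real symmetric $N\times N$ matrix indexed by vertices whose $(u,v)$ entry is $d_G(u)d_{\overline{G}}(u)+d_G(v)d_{\overline{G}}(v)$ if $u$ and $v$ are adjacent in $G$, and $0$ otherwise. The Lanzhou spectrum of $G$ is the multiset of eigenvalues of $A_{Lz}(G)$. The inertia $In(M)=(n_+,n_-,n_0)$ of a real symmetric matrix $M$ gives its numbers of positive, negative and zero eigenvalues (with multiplicity). The crown graph $S_n^0$ has vertices $x_1,\ldots,x_n,y_1,\ldots,y_n$, with $x_i$ adjacent to $y_j$ exactly when $i\neq j$, and no other edges. *)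

(* Defs.v *)
From HB Require Import structures.
From mathcomp Require Import all_boot all_order all_algebra.
From mathcomp Require Import polyrcf.

Set Implicit Arguments.
Unset Strict Implicit.
Unset Printing Implicit Defensive.

Import Order.TTheory GRing.Theory Num.Theory.
Local Open Scope ring_scope.

Record sgraph (V : finType) := SGraph {
  adj :> rel V;
  adj_sym : symmetric adj;
  adj_irr : irreflexive adj }.

Definition deg (V : finType) (G : sgraph V) (u : V) : nat := #|[set v | G u v]|.

Section Complement.
Variables (V : finType) (G : sgraph V).

Definition compl_rel : rel V := fun u v => (u != v) && ~~ G u v.

Fact compl_sym : symmetric compl_rel.
Proof. by move=> u v; rewrite /compl_rel eq_sym adj_sym. Qed.

Fact compl_irr : irreflexive compl_rel.
Proof. by move=> u; rewrite /compl_rel eqxx. Qed.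

Definition compl : sgraph V := SGraph compl_sym compl_irr.

Lemma deg_compl u : deg compl u = (#|V| - 1 - deg G u)%N.
Proof.
have -> : deg compl u = #|~: (u |: [set v | G u v])|.
  by apply: eq_card => v; rewrite !inE /= /compl_rel negb_or eq_sym.
by rewrite cardsCs setCK cardsU1 inE adj_irr subnDA.
Qed.

End Complement.

(* Rows and columns are indexed by the vertices through [enum_val]. *)
Definition lanzhou_mx (R : pzRingType) (V : finType) (G : sgraph V) :
    'M[R]_#|V| :=
  \matrix_(i, j)
    let u := enum_val i in let v := enum_val j in
    if G u v
    then (deg G u * deg (compl G) u + deg G v * deg (compl G) v)%:R
    else 0.

Section Spectrum.
Variables (R : rcfType) (n : nat).

(* The eigenvalues lying in [R], each repeated according to its multiplicity as
   a root of the characteristic polynomial; a multiset is a sequence up to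
   [perm_eq].  A symmetric matrix has all its eigenvalues in [R], and for it
   algebraic and geometric multiplicities agree. *)
Definition spectrum (M : 'M[R]_n) : seq R :=
  flatten [seq nseq (mup x (char_poly M)) x | x <- rootsR (char_poly M)].

Lemma count_spectrum (M : 'M[R]_n) x :
  count_mem x (spectrum M) = mup x (char_poly M).
Proof.
have p0 : char_poly M != 0 by rewrite monic_neq0 ?char_poly_monic.
have xE : (x \in rootsR (char_poly M)) = root (char_poly M) x.
  by rewrite -(roots_on_rootsR p0 x) in_itv.
have cE s : uniq s ->
    count_mem x (flatten [seq nseq (mup z (char_poly M)) z | z <- s]) =
    ((x \in s) * mup x (char_poly M))%N.
  elim: s => // y s IHs /andP[ys /IHs {}IHs].
  rewrite count_cat count_nseq IHs /=.
  by rewrite in_cons; have [->|] := eqVneq x y; rewrite ?(negPf ys) ?addn0.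
rewrite cE ?uniq_roots // xE.
by case: (boolP (root _ _)) => [_|/mupNroot->]; rewrite ?mul1n.
Qed.

Definition inertia (M : 'M[R]_n) : nat * nat * nat :=
  (count (fun x => 0 < x) (spectrum M),
   count (fun x => x < 0) (spectrum M),
   count (fun x => x == 0) (spectrum M)).

End Spectrum.

Section Crown.
Variable n : nat.

(* [inl i] is the vertex x_i and [inr j] is the vertex y_j. *)
Definition crown_rel : rel ('I_n + 'I_n)%type := fun u v =>
  match u, v with
  | inl i, inr j | inr j, inl i => i != j
  | _, _ => false
  end.

Fact crown_sym : symmetric crown_rel.
Proof. by move=> [i|i] [j|j]. Qed.

Fact crown_irr : irreflexive crown_rel.
Proof. by move=> [i|i]. Qed.

Definition crown : sgraph ('I_n + 'I_n)%type := SGraph crown_sym crown_irr.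

End Crown.

(* Main.v *)
(* The degrees in the crown graph are n - 1 and those in its complement are n,
   so its Lanzhou matrix is a times its adjacency matrix, that is, the block
   matrix with rows (0, a(J - I)) and (a(J - I), 0), where J is the all-ones
   matrix.  Adding rows and subtracting columns splits the determinant of
   [P, Q; Q, P] as det (P + Q) det (P - Q), and each factor is the determinant
   of a scalar matrix plus a rank one matrix. *)
Require Import Defs.
From mathcomp Require Import all_boot all_order all_algebra.
From mathcomp Require Import perm reals.
From mathcomp Require Import ring zify.

Import Order.TTheory GRing.Theory Num.Theory.
Local Open Scope ring_scope.

(** An injection between ordinals of equal size is a permutation; applied to rows and columns alike,
    its sign occurs twice and cancels. This allows a matrix indexed by [#|V|] to be rearranged into
    blocks. *)
Lemma det_mxsub_inj (R : comPzRingType) (m n : nat) (f : 'I_m -> 'I_n)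
    (M : 'M[R]_n) :
  injective f -> m = n -> \det (mxsub f f M) = \det M.
Proof.
move=> f_inj eq_mn; case: n / eq_mn f M f_inj => f M f_inj.
have -> : mxsub f f M = row_perm (perm f_inj) (col_perm (perm f_inj) M).
  by apply/matrixP=> i j; rewrite !mxE !permE.
rewrite row_permE col_permE !det_mulmx !det_perm odd_permV mulrCA.
by rewrite -signr_addb addbb mulr1.
Qed.

Lemma det_block_swap (R : comPzRingType) (n : nat) (P Q : 'M[R]_n) :
  \det (block_mx P Q Q P) = \det (P + Q) * \det (P - Q).
Proof.
have E : block_mx 1%:M 1%:M 0 1%:M *m block_mx P Q Q P
           *m block_mx 1%:M (- 1%:M) 0 1%:M = block_mx (P + Q) 0 Q (P - Q).
  rewrite !mulmx_block !(mul1mx, mul0mx, mulmx1, mulmx0, mulmxN) !(addr0, add0r).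
  by congr (block_mx _ _ _ _); rewrite addrC ?(addrC Q P) ?subrr.
have := congr1 (fun M : 'M_(n + n) => \det M) E.
by rewrite !det_mulmx !det_ublock det_lblock !det1 !(mul1r, mulr1).
Qed.

(** Both sides equal [x ^+ m * \det B] for the bordered matrix [B]: one triangular multiplier has
    determinant 1, the other [x ^+ m]. No division by [x] occurs. *)
Lemma det_scalar_sub_mulmx (R : comPzRingType) (m n : nat) (x : R)
    (u : 'M[R]_(n, m)) (v : 'M[R]_(m, n)) :
  x ^+ m * \det (x%:M - u *m v) = x ^+ n * \det (x%:M - v *m u).
Proof.
pose B := block_mx x%:M u v 1%:M.
have El : B *m block_mx 1%:M 0 (- v) 1%:M = block_mx (x%:M - u *m v) u 0 1%:M.
  rewrite mulmx_block !(mul1mx, mulmx1, mulmx0, mulmxN) !(addr0, add0r).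
  by rewrite subrr.
have Er : block_mx 1%:M 0 (- v) x%:M *m B = block_mx x%:M u 0 (x%:M - v *m u).
  rewrite mulmx_block !(mul1mx, mul0mx, mulmx1, mulNmx) !(addr0, add0r).
  by rewrite scalar_mxC addNr (addrC (- _)).
have := congr1 (fun M : 'M_(n + m) => \det M) El.
rewrite det_mulmx det_ublock det_lblock !det1 !mulr1 => <-.
have := congr1 (fun M : 'M_(n + m) => \det M) Er.
by rewrite det_mulmx det_lblock det_ublock det1 mul1r !det_scalar.
Qed.

(** A constant matrix is a column times a row, so swapping the factors leaves a 1 by 1 determinant;
    [x != 0] allows the surplus factor [x] to be cancelled. *)
Lemma det_scalar_sub_const (R : idomainType) (n : nat) (x c : R) :
  x != 0 -> \det (x%:M - const_mx c : 'M_n.+1) = x ^+ n * (x - c *+ n.+1).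
Proof.
move=> x0; apply: (mulfI x0).
have -> : const_mx c = (const_mx c : 'cV_n.+1) *m (const_mx 1 : 'rV_n.+1)
    :> 'M[R]_n.+1.
  by apply/matrixP=> i j; rewrite !mxE big_ord1 !mxE mulr1.
have := @det_scalar_sub_mulmx _ 1 n.+1 x (const_mx c) (const_mx 1).
rewrite expr1 => ->; rewrite mulrA -exprS; congr (_ * _).
rewrite det_mx11 !mxE eqxx; congr (_ - _).
rewrite (eq_bigr (fun=> c)) => [|i _]; last by rewrite !mxE mul1r.
by rewrite sumr_const card_ord.
Qed.

Lemma mup_prod_XsubC (F : fieldType) (x : F) (s : seq F) :
  mup x (\prod_(z <- s) ('X - z%:P)) = count_mem x s.
Proof.
elim: s => [|y s IHs]; first by rewrite big_nil mupNroot ?root1.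
rewrite big_cons mupM ?polyXsubC_eq0 ?monic_neq0 ?monic_prod_XsubC // IHs.
by rewrite -['X - y%:P]expr1 mup_XsubCX /=; case: eqVneq.
Qed.

(** Each value occurs on both sides as often as its multiplicity as a root. As [s] may have
    repetitions, coinciding eigenvalues need no case split. *)
Lemma perm_spectrum (R : rcfType) (n : nat) (M : 'M[R]_n) (s : seq R) :
  char_poly M = \prod_(z <- s) ('X - z%:P) -> perm_eq (spectrum M) s.
Proof.
move=> Ms; apply/allP=> x _ /=.
by rewrite count_spectrum Ms mup_prod_XsubC.
Qed.

Lemma deg_crown (n : nat) (u : 'I_n + 'I_n) : deg (crown n) u = n.-1.
Proof.
have cardD1 (i : 'I_n) : #|[set~ i]| = n.-1 by rewrite cardsC1 card_ord.
case: u => i; rewrite -(cardD1 i) /deg.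
- rewrite -(card_imset [set~ i] (inr_inj (A := 'I_n) (B := 'I_n))).
  apply: eq_card => -[j|j]; rewrite inE /=.
    by apply/esym/imsetP => -[].
  by rewrite mem_imset ?inE 1?eq_sym //; apply: inr_inj.
- rewrite -(card_imset [set~ i] (inl_inj (A := 'I_n) (B := 'I_n))).
  apply: eq_card => -[j|j]; rewrite inE /=.
    by rewrite mem_imset ?inE 1?eq_sym //; apply: inl_inj.
  by apply/esym/imsetP => -[].
Qed.

Lemma char_poly_lanzhou_crown (R : rcfType) (n : nat) :
  let a : R := (2 * n.+1 * n)%:R in
  char_poly (lanzhou_mx R (crown n.+1)) =
    ('X + a%:P) ^+ n * ('X - (a * n%:R)%:P) *
    (('X - a%:P) ^+ n * ('X + (a * n%:R)%:P)).
Proof.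
move=> a; set A := lanzhou_mx R _.
have AE u v : A (enum_rank u) (enum_rank v) = if crown n.+1 u v then a else 0.
  rewrite mxE /= !enum_rankK !deg_compl !deg_crown card_sum !card_ord.
  by case: ifP => // _; rewrite /a; congr (_%:R); lia.
(* [f] lists all x vertices, then all y vertices; from here on only the entries [AE] of [A]
   matter. *)
clearbody A; pose f (i : 'I_(n.+1 + n.+1)) := enum_rank (split i).
have f_inj : injective f.
  by move=> i j /enum_rank_inj/(can_inj (@splitK _ _)).
rewrite /char_poly -(@det_mxsub_inj _ _ _ f) ?card_sum ?card_ord //.
have -> : mxsub f f (char_poly_mx A) =
    block_mx 'X%:M (a%:P%:M - const_mx a%:P) (a%:P%:M - const_mx a%:P) 'X%:M.
  apply/matrixP=> i j; rewrite mxE.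
  have -> : char_poly_mx A (f i) (f j) = 'X *+ (i == j) -
      (if crown n.+1 (split i) (split j) then a else 0)%:P.
    by rewrite !mxE (inj_eq f_inj) AE.
  case: (split_ordP i) => i' ->; case: (split_ordP j) => j' ->;
    rewrite (block_mxEul, block_mxEur, block_mxEdl, block_mxEdr) !mxE /=;
    rewrite ?eq_shift ?mulr0n ?sub0r /= ?polyC0 ?subr0 //.
  - by case: eqVneq => _; rewrite ?polyC0 ?subrr ?oppr0 ?sub0r.
  - by rewrite eq_sym; case: eqVneq => _; rewrite ?polyC0 ?subrr ?oppr0 ?sub0r.
rewrite det_block_swap.
(* At order [n.+1] the two linear factors will be X + a - a(n+1) = X - an and X - a + a(n+1) = X +
   an. *)
have -> : 'X%:M + (a%:P%:M - const_mx a%:P) =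
    ('X + a%:P)%:M - const_mx a%:P :> 'M_n.+1.
  by rewrite addrA -raddfD.
have -> : 'X%:M - (a%:P%:M - const_mx a%:P) =
    ('X - a%:P)%:M - const_mx (- a%:P) :> 'M_n.+1.
  by rewrite opprB addrCA addrC -raddfB raddfN /= opprK.
rewrite !det_scalar_sub_const ?polyXsubC_eq0 //; last first.
  by rewrite -[a]opprK polyCN polyXsubC_eq0.
rewrite mulNrn opprK mulrSr mulr_natr polyCMn.
by congr (_ * _ * (_ * _)); ring.
Qed.

Theorem theorem32 (R : realType) (n : nat) (hn : (2 <= n)%N) :
  let a : R := 2%:R * n%:R * (n%:R - 1) in
  let A : 'M[R]_#|{: 'I_n + 'I_n}| := lanzhou_mx R (crown n) in
  perm_eq (spectrum A)
    (nseq (n - 1) (- a) ++ nseq 1 (a * (n%:R - 1)) ++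
     nseq (n - 1) a ++ nseq 1 (- (a * (n%:R - 1)))) /\
  inertia A = (n, n, 0%N).
Proof.
case: n hn => // n n_gt0 a A.
have n0 : 0 < n%:R :> R by rewrite ltr0n.
have n1E : n.+1%:R - 1 = n%:R :> R by rewrite -natr1 addrK.
have aE : a = (2 * n.+1 * n)%:R by rewrite /a n1E !natrM.
(* With [n] now one less than the original, the bound [2 <= n.+1] makes [a] and [a * n%:R] positive,
   so 0 is not an eigenvalue. *)
have a0 : 0 < a by rewrite aE ltr0n !muln_gt0.
have an0 : 0 < a * n%:R by rewrite mulr_gt0.
rewrite n1E subn1 /=; set s := _ ++ _.
have sA : perm_eq (spectrum A) s.
  apply: perm_spectrum; rewrite char_poly_lanzhou_crown -aE.
  rewrite !(big_cat, big_cons, big_nil) !big_nseq -!Monoid.iteropE /=.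
  by rewrite !polyCN !opprK !mulrA mulr1.
(* The counts are read off [s]: each sign is carried by a block of [n] entries and one single entry,
   hence by [n.+1] in all. *)
split=> //; rewrite /inertia !(seq.permP sA).
rewrite !count_cat /= !count_cat !count_nseq /=.
rewrite !oppr_gt0 !oppr_lt0 !oppr_eq0 a0 an0 !gt_eqF // !ltNge !ltW //=.
by rewrite !mul0n !mul1n !addn0 !add0n add1n addn1.
Qed.
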